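(* Let $G$ be a commutative cancellative semigroup of uncountable cardinality $\kappa$. Then there exists a map $d:G\rightarrow[\kappa]^{<\omega}$ such that for every uncountable $X\subseteq G$ there exists $A\subseteq\kappa$ with $|A|=|X|$ and $$\{d(s)\mid s\in\mathrm{FS}(X)\}\supseteq[A]^{<\omega}.$$
   Context: $[\kappa]^{<\omega}$ denotes the set of all finite subsets of $\kappa$. For a subset $X$ of a commutative semigroup $G$, $\mathrm{FS}(X):=\{\sum_{x\in a}x\mid a \text{ a nonempty finite subset of } X\}$ is the set of finite sums of distinct elements of $X$. *)

(* Defs.v *)
From mathcomp Require Import all_boot all_algebra finmap.
From mathcomp Require Import boolp classical_sets functions cardinality.

Set Implicit Arguments.
Unset Strict Implicit.
Unset Printing Implicit Defensive.

Local Open Scope classical_set_scope.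
Local Open Scope ring_scope.

(* A semigroup need not have a neutral element, so the iterated sum is taken in
   option G through oAC, with None as the value of the empty sum. Sums of
   nonempty finite sets are always of the form Some s. *)
Definition FS (G : addSemigroupType) (X : set G) : set G :=
  [set s | exists a : {fset G}, [/\ a != fset0, [set` a] `<=` X &
     \big[oAC (@Algebra.addrA G) (@Algebra.addrC G)/None]_(x <- a) Some x = Some s]].

(* Main.v *)
(* A cancellative commutative semigroup G embeds in a direct sum, indexed by G, of
   copies of a countable divisible group (here the nonzero algebraic numbers),
   so that each x has a finite support. Let d(s) be a subset of the support of
   s: which one is decided by reading a natural number off the size of the
   support, and interpreting this number as a list of positions in a fixed
   linear order of the coordinates.
   Given an uncountable X, well-order it and select for each x in X, when there
   is one, a coordinate in the support of x that lies in no earlier support.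
   The set A of these coordinates has the size of X, and every finite subset a
   of A is, by triangularity, contained in the support of a subset sum of X.
   Adding to this sum m further elements of X that share a common part and have
   otherwise new, pairwise disjoint supports moves the positions of a, and the
   size of the support, linearly in m; so m may be chosen such that this size
   transmits the description of a. *)
Require Import Defs.
From HB Require Import structures.
From mathcomp Require Import all_boot all_algebra all_field finmap.
From mathcomp Require Import boolp classical_sets functions cardinality wochoice.

Set Implicit Arguments.
Unset Strict Implicit.
Unset Printing Implicit Defensive.

Import GRing.Theory Num.Theory.

Local Open Scope classical_set_scope.
Local Open Scope card_scope.
Local Open Scope ring_scope.

(** * Embedding in a direct sum of countable groups *)

Section DifferenceGroup.
Context (G : addSemigroupType).
Context (cancel_add : forall x y z : G, x + y = x + z -> y = z).
Context (e : G).
Local Open Scope quotient_scope.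

(** A pair [u] stands for the formal difference of [u.1] and [u.2]; the quotient is the Grothendieck
    group of [G]. Cancellation makes the relation transitive. *)
Definition diff_eq (u v : G * G) := u.1 + v.2 == v.1 + u.2.

Lemma diff_eq_refl : reflexive diff_eq. Proof. by move=> u; apply: eqxx. Qed.
Lemma diff_eq_sym : symmetric diff_eq. Proof. by move=> u v; rewrite /diff_eq eq_sym. Qed.
Lemma diff_eq_trans : transitive diff_eq.
Proof.
move=> [c d] [a b] [i j]; rewrite /diff_eq /= => /eqP ad /eqP cj; apply/eqP.
apply: (cancel_add (x := c + d)).
rewrite (Algebra.addrC a j) [LHS]Algebra.addrACA (Algebra.addrC d a) ad cj.
by rewrite (Algebra.addrC i d) (Algebra.addrC c d) Algebra.addrACA.
Qed.

Canonical diff_equiv := EquivRel diff_eq diff_eq_refl diff_eq_sym diff_eq_trans.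
Definition diff := {eq_quot diff_eq}.
HB.instance Definition _ : EqQuotient _ diff_eq diff := EqQuotient.on diff.
HB.instance Definition _ := Choice.on diff.

Lemma diff_pi (u v : G * G) : \pi_diff u = \pi_diff v <-> u.1 + v.2 = v.1 + u.2.
Proof. by split=> [/eqmodP/eqP|h] //; apply/eqmodP/eqP. Qed.

Definition diff_add (x y : diff) : diff :=
  \pi_diff ((repr x).1 + (repr y).1, (repr x).2 + (repr y).2).
Definition diff_opp (x : diff) : diff := \pi_diff ((repr x).2, (repr x).1).
Definition diff_zero : diff := \pi_diff (e, e).

Lemma diff_reprE u : (repr (\pi_diff u)).1 + u.2 = u.1 + (repr (\pi_diff u)).2.
Proof. by apply/(diff_pi (repr (\pi_diff u)) u); rewrite reprK. Qed.

Lemma diff_addE u v :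
  diff_add (\pi_diff u) (\pi_diff v) = \pi_diff (u.1 + v.1, u.2 + v.2).
Proof.
apply/diff_pi => /=; have := diff_reprE v; have := diff_reprE u.
set a := repr _; set b := repr _ => ua vb.
by rewrite Algebra.addrACA ua vb Algebra.addrACA.
Qed.

Lemma diff_oppE u : diff_opp (\pi_diff u) = \pi_diff (u.2, u.1).
Proof.
apply/diff_pi => /=; have := diff_reprE u; set a := repr _ => ua.
by rewrite Algebra.addrC -ua Algebra.addrC.
Qed.

Lemma diff_ind (P : diff -> Prop) : (forall u, P (\pi_diff u)) -> forall x, P x.
Proof. by move=> Pu x; rewrite -[x]reprK. Qed.

Lemma diff_addA : associative diff_add.
Proof.
move=> x y z; move: x y z; do 3 (apply: diff_ind => ?).
by rewrite !diff_addE/= !Algebra.addrA.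
Qed.
Lemma diff_addC : commutative diff_add.
Proof.
move=> x y; move: x y; do 2 (apply: diff_ind => ?).
by rewrite !diff_addE/=; congr (\pi_diff (_, _)); apply: Algebra.addrC.
Qed.
Lemma diff_add0 : left_id diff_zero diff_add.
Proof.
by apply: diff_ind => u; rewrite diff_addE/=; apply/diff_pi; rewrite /= (Algebra.addrC e) Algebra.addrA.
Qed.
Lemma diff_addN : left_inverse diff_zero diff_opp diff_add.
Proof.
apply: diff_ind => u; rewrite diff_oppE diff_addE/=; apply/diff_pi => /=.
by rewrite Algebra.addrC (Algebra.addrC u.2).
Qed.
HB.instance Definition _ := GRing.isZmodule.Build diff diff_addA diff_addC diff_add0 diff_addN.

(** [G] may lack a neutral element, so [x] is represented as the difference of [x + e] and [e] for
    an arbitrary base point [e]. *)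
Lemma difference_group : exists (K : zmodType) (i : G -> K),
  injective i /\ {morph i : x y / x + y}.
Proof.
exists diff; exists (fun x => \pi_diff (x + e, e)); split=> [x y|x y].
  move=> /diff_pi /= h; apply: (cancel_add (x := e + e)).
  by rewrite (Algebra.addrC _ x) (Algebra.addrC _ y) !Algebra.addrA.
rewrite [RHS]diff_addE/=; apply/diff_pi => /=.
by rewrite (Algebra.addrACA x e) !Algebra.addrA.
Qed.
End DifferenceGroup.

(** * Multiples and roots of a new generator *)

(** The integers [m] with [x *~ m] in [D] form a subgroup, generated by its least positive member,
    or by 0 if it has none. *)
Lemma multiples_in_subgroup (K : zmodType) (D : set K) (x : K) :
  D 0 -> (forall a b, D a -> D b -> D (a - b)) ->
  exists n : nat, forall m : int, D (x *~ m) <-> (n %| m)%Z.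
Proof.
move=> D0 Dsub.
have Dopp a : D a -> D (- a) by move=> Da; rewrite -[- a]add0r; apply: Dsub.
have Dadd a b : D a -> D b -> D (a + b).
  by move=> Da Db; rewrite -[b]opprK; apply: Dsub => //; apply: Dopp.
have Dmul a (m : int) : D a -> D (a *~ m).
  move=> Da; have Dn (k : nat) : D (a *+ k).
    by elim: k => [|k IH]; rewrite ?mulr0n // mulrS; apply: Dadd.
  by case: m => k; [exact: Dn | rewrite NegzE mulrNz; apply/Dopp/Dn].
have [ex|nex] := pselect (exists n, `[< (0 < n)%N /\ D (x *+ n) >]); last first.
  exists 0%N => m; rewrite dvd0z; split=> [Dm|/eqP->]; last by rewrite mulr0z.
  apply: contrapT => /negP m0; apply: nex; exists `|m|%N; apply/asboolP; split.
    by rewrite absz_gt0.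
  by case: m Dm {m0} => k; rewrite ?NegzE // mulrNz => /Dopp; rewrite opprK.
case: (ex_minnP ex) => n /asboolP[n0 Dn] nmin; exists n => m; split; last first.
  by move=> /dvdzP[q ->]; rewrite mulrC mulrzA; apply: Dmul.
move=> Dm; apply/dvdz_mod0P; set r := (m %% n)%Z.
have r0 : 0 <= r by apply: modz_ge0; rewrite eqz_nat -lt0n.
have rn : r < n by rewrite ltz_pmod.
have Dr : D (x *~ r).
  rewrite /r /modz mulrzBr; apply: Dsub => //.
  by rewrite [(_ * _)%R]mulrC mulrzA; apply: Dmul.
case: r r0 rn Dr => // -[|k] // _ kn Dk.
suff : (n <= k.+1)%N by rewrite leqNgt -ltz_nat kn.
by apply: nmin; apply/asboolP.
Qed.

(** These are values for a new generator whose [n]-th multiple already has image [y]. At [i0] the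
    value has order exactly [n] (infinite for [n = 0]), which will give injectivity. Elsewhere any
    [n]-th root serves, but 1 is taken where [y] is 1, to keep supports finite. *)
Lemma root_character (I : Type) (n : nat) (y : I -> algC) (i0 : I) :
  (forall i, y i != 0) -> y i0 = 1 -> (n = 0%N -> forall i, y i = 1) ->
  exists w : I -> algC, [/\ forall i, w i != 0, forall i, w i ^+ n = y i,
    forall m : int, w i0 ^ m = 1 -> (n %| m)%Z &
    forall i, i <> i0 -> y i = 1 -> w i = 1].
Proof.
move=> y0 yi0 yn.
have [z z0 [zn zm]] : exists2 z : algC, z != 0 &
    z ^+ n = 1 /\ forall m : int, z ^ m = 1 -> (n %| m)%Z.
  case: n {yn} => [|n]; last first.
    have [z pz] := C_prim_root_exists (ltn0Sn n); exists z.
      by apply: contra_eq_neq (prim_expr_order pz) => ->; rewrite expr0n eq_sym oner_eq0.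
    split; first exact: prim_expr_order pz.
    case=> k zk; rewrite dvdzE /=.
      by rewrite (prim_order_dvd pz); apply/eqP.
    rewrite (prim_order_dvd pz); apply/eqP.
    by apply: invr_inj; rewrite invr1.
  exists 2%:R; first by rewrite pnatr_eq0.
  split=> // m; have two k : (2%:R ^+ k.+1 : algC) <> 1.
    by move/eqP; rewrite pexpr_eq1 ?ler0n // -[1]/(1%:R) eqr_nat.
  case: m => [[|k]|k] // h; first by have := two _ h.
  by case: (two k); apply: invr_inj; rewrite invr1.
exists (fun i => if `[< i = i0 >] then z else if y i == 1 then 1 else n.-root (y i)).
split=> [i|i|m|i].
- case: asboolP => // _; case: (eqVneq (y i) 1) => [_|/eqP yi1]; first exact: oner_neq0.
  case: n yn {zn zm} => [/(_ erefl i)//|n _].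
  by rewrite rootC_eq0.
- case: asboolP => [->|_]; first by rewrite yi0 zn.
  case: (eqVneq (y i) 1) => [->|/eqP yi1]; first by rewrite expr1n.
  by case: n yn {zn zm} => [/(_ erefl i)//|n _]; rewrite rootCK.
- by case: asboolP => // _; apply: zm.
- by move=> ii0 ->; rewrite eqxx; case: asboolP.
Qed.

(** * Extending embeddings of subgroups by Zorn's lemma *)

Section Embedding.
Context (K : zmodType) (I : Type) (i : I -> K).

Record partial_embedding (R : set (K * (I -> algC))) : Prop := PartialEmbedding {
  pembB : forall x f y g, R (x, f) -> R (y, g) -> R (x - y, fun j => f j / g j);
  pemb_inj : forall x, R (x, fun=> 1) -> x = 0;
  pemb_fun : forall f, R (0, f) -> f = fun=> 1;
  pemb_neq0 : forall x f, R (x, f) -> forall j, f j != 0;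
  pemb_fin : forall x f, R (x, f) -> finite_set [set j | f j != 1];
  pemb_supp : forall x f, R (x, f) -> forall j, f j != 1 -> exists h, R (i j, h) }.

Lemma partial_embedding_bigcup (C : set (set (K * (I -> algC)))) :
  C `<=` partial_embedding -> total_on C subset ->
  partial_embedding (\bigcup_(R in C) R).
Proof.
move=> CP Ctot; split.
- move=> x f y g [R CR Rx] [S CS Sy].
  have [RS|SR] := Ctot _ _ CR CS.
    by exists S => //; apply: (pembB (CP _ CS)) => //; apply: RS.
  by exists R => //; apply: (pembB (CP _ CR)) => //; apply: SR.
- by move=> x [R CR] /(pemb_inj (CP _ CR)).
- by move=> f [R CR] /(pemb_fun (CP _ CR)).
- by move=> x f [R CR] /(pemb_neq0 (CP _ CR)).
- by move=> x f [R CR] /(pemb_fin (CP _ CR)).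
- move=> x f [R CR] /(pemb_supp (CP _ CR)) h j /h[g Rg]; exists g.
  by exists R.
Qed.

Lemma partial_embedding0 : partial_embedding [set (0, fun=> 1)].
Proof.
split=> //.
- by move=> x f y g [-> ->] [-> ->]; rewrite subr0; congr (_, _); apply/funext => j; rewrite divr1.
- by move=> x [].
- by move=> f [].
- by move=> x f [_ ->] j; apply: oner_neq0.
- move=> x f [_ ->]; rewrite (_ : [set _ | _] = set0) //.
  by apply/seteqP; split=> j //=; rewrite eqxx.
- by move=> x f [_ ->] j; rewrite eqxx.
Qed.

(* The new generator [i j0] gets the coordinate [j0] for itself; its remaining
   coordinates are n-th roots of those of its least multiple already in the
   domain. *)
Lemma partial_embedding_extend (R : set (K * (I -> algC))) (j0 : I) :
  partial_embedding R -> R (0, fun=> 1) -> (forall h, ~ R (i j0, h)) ->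
  exists S, [/\ partial_embedding S, R `<=` S & exists h, S (i j0, h)].
Proof.
move=> PR R0 nRj0.
pose D := [set x | exists f, R (x, f)].
have D0 : D 0 by exists (fun=> 1).
have DB a b : D a -> D b -> D (a - b).
  by move=> [f Rf] [g Rg]; exists (fun j => f j / g j); apply: pembB.
have [n nP] := multiples_in_subgroup (i j0) D0 DB.
have [y Ry] : D (i j0 *~ n) by apply/nP.
have Rj0 x f : R (x, f) -> f j0 = 1.
  by move=> Rx; apply: contrapT => /eqP /(pemb_supp PR Rx) [h /nRj0].
have [n0 j|w [w0 wn wm w1]] := root_character (n := n) (pemb_neq0 PR Ry) (Rj0 _ _ Ry).
  by move: Ry; rewrite n0 mulr0z => /(pemb_fun PR) ->.
have RN x f : R (x, f) -> R (- x, fun j => (f j)^-1).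
  move=> Rx; have := pembB PR R0 Rx; rewrite sub0r.
  by under eq_fun do rewrite div1r.
have RD x f x' f' : R (x, f) -> R (x', f') -> R (x + x', fun j => f j * f' j).
  move=> Rx Rx'; have := pembB PR Rx (RN _ _ Rx'); rewrite opprK.
  by under eq_fun do rewrite invrK.
(* On multiples of [n] the powers of [w] agree with the images already assigned, since
   [w ^+ n = y]. *)
have RM (q : int) : R (i j0 *~ (n%:Z * q), fun j => w j ^ (n%:Z * q)).
  have Rn (k : nat) : R (i j0 *~ (n%:Z * k%:Z), fun j => w j ^ (n%:Z * k%:Z)).
    elim: k => [|k IH].
      by rewrite mulr0 mulr0z; under eq_fun do rewrite expr0z.
    rewrite -addn1 PoszD !mulrDr mulr1 mulrzDr.
    have := RD _ _ _ _ IH Ry; congr (R (_, _)); apply/funext => j.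
    by rewrite expfzDr // -wn.
  case: q => k //; rewrite NegzE mulrN mulrNz.
  have := RN _ _ (Rn k.+1); congr (R (_, _)); apply/funext => j.
  by rewrite invr_expz.
pose S := [set u | exists x f (m : int), R (x, f) /\
  u = (x + i j0 *~ m, fun j => f j * w j ^ m)].
have RS : R `<=` S.
  move=> [x f] Rx; exists x, f, 0; split=> //; rewrite mulr0z addr0; congr (_, _).
  by apply/funext => j; rewrite expr0z mulr1.
have Sj0 : S (i j0, w).
  exists 0, (fun=> 1), 1; split=> //; rewrite add0r mulr1z; congr (_, _).
  by apply/funext => j; rewrite expr1z mul1r.
exists S; split=> //; last by exists w.
split.
- move=> _ _ _ _ [x [f [m [Rx [-> ->]]]]] [x' [f' [m' [Rx' [-> ->]]]]].
  exists (x - x'), (fun j => f j / f' j), (m - m'); split; first exact: pembB.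
  congr (_, _); first by rewrite mulrzBr opprD addrACA.
  apply/funext => j; rewrite expfzDr // -invr_expz invfM.
  by rewrite mulrACA.
(* Injectivity: at [j0] only the factor [w j0 ^ m] remains, so [n] divides [m] and the pair lies in
   [R] already. *)
- move=> _ [x [f [m [Rx [-> fw]]]]].
  have : (n %| m)%Z.
    by apply: wm; have := congr1 (@^~ j0) fw; rewrite /= (Rj0 _ _ Rx) mul1r.
  move=> /dvdzP[q mq]; apply: (pemb_inj PR).
  have := RD _ _ _ _ Rx (RM q); congr (R (_, _)); first by rewrite mq mulrC.
  by rewrite fw mq mulrC.
(* Single-valuedness: [x + i j0 *~ m = 0] puts [i j0 *~ m] into the old domain, so again [n] divides
   [m]. *)
- move=> _ [x [f [m [Rx [xm ->]]]]].
  have : (n %| m)%Z.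
    apply/nP; exists (fun j => (f j)^-1).
    have -> : i j0 *~ m = - x by apply/eqP; rewrite -addr_eq0 addrC -xm.
    exact: RN.
  move=> /dvdzP[q mq]; apply: (pemb_fun PR).
  by have := RD _ _ _ _ Rx (RM q); rewrite [n%:Z * q]mulrC -mq -xm.
- move=> _ _ [x [f [m [Rx [_ ->]]]]] j.
  by rewrite mulf_neq0 ?expfz_neq0 // (pemb_neq0 PR Rx).
- move=> _ _ [x [f [m [Rx [_ ->]]]]].
  apply: (@sub_finite_set _ _ ([set j | f j != 1] `|` [set j | y j != 1] `|` [set j0])).
    move=> j /= /eqP fw; apply: contrapT => /not_orP[/not_orP[/negP/negPn/eqP fj /negP/negPn/eqP yj] jj0].
    by apply: fw; rewrite fj w1 // exp1rz mulr1.
  by rewrite !finite_setU; split=> //; split; [apply: (pemb_fin PR Rx)|apply: (pemb_fin PR Ry)].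
- move=> _ _ [x [f [m [Rx [_ ->]]]]] j /eqP fw.
  have [->|jj0] := pselect (j = j0); first by exists w.
  have [fj|/(pemb_supp PR Rx)[h Rh]] := eqVneq (f j) 1; last by exists h; apply: RS.
  have [yj|/(pemb_supp PR Ry)[h Rh]] := eqVneq (y j) 1; last by exists h; apply: RS.
  by case: fw; rewrite fj w1 // exp1rz mulr1.
Qed.

Lemma total_embedding : exists R, partial_embedding R /\ forall j, exists h, R (i j, h).
Proof.
have [R [PR Rmax]] := Zorn_bigcup partial_embedding_bigcup.
(* Maximality excludes the empty relation, and a nonempty one contains the difference of a pair with
   itself. *)
have R0 : R (0, fun=> 1).
  apply: contrapT => nR0; have [[[x f] Rx]|Re] := pselect (R !=set0).
    apply: nR0; have := pembB PR Rx Rx; rewrite subrr; congr (R (_, _)).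
    by apply/funext => j; rewrite divff // (pemb_neq0 PR Rx).
  apply: (Rmax _ _ partial_embedding0); split=> [u Ru|/(_ _ erefl)//].
  by case: Re; exists u.
exists R; split=> // j; apply: contrapT => nRj.
have [h Rh|S [PS RS [h Sj]]] := @partial_embedding_extend R j PR R0.
  by apply: nRj; exists h.
apply: (Rmax S) => //; split=> // SR; apply: nRj; exists h; exact: SR.
Qed.

End Embedding.

Lemma semigroup_embedding (G : addSemigroupType) :
  (forall x y z : G, x + y = x + z -> y = z) ->
  exists F : G -> G -> algC, [/\ injective F, forall x j, F x j != 0,
    forall x, finite_set [set j | F x j != 1] &
    forall x y j, F (x + y) j = F x j * F y j].
Proof.
move=> cancel_add; have [[e]|Ge] := pselect (exists e : G, True); last first.
  by exists (fun _ _ => 1); split=> [x|x|x|x]; case: Ge; exists x.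
have [K [i [iinj iD]]] := difference_group cancel_add e.
have [R [PR Ri]] := total_embedding i.
have [F FR] := choice Ri; exists F; split.
- move=> x y Fxy; apply/iinj/eqP; rewrite -subr_eq0; apply/eqP/(pemb_inj PR).
  have := pembB PR (FR x) (FR y); congr (R (_, _)); apply/funext => j.
  by rewrite Fxy divff // (pemb_neq0 PR (FR y)).
- by move=> x; apply: (pemb_neq0 PR (FR x)).
- by move=> x; apply: (pemb_fin PR (FR x)).
- move=> x y j.
  have := pembB PR (pembB PR (FR (x + y)) (FR x)) (FR y).
  rewrite iD -addrA -opprD subrr => /(pemb_fun PR) /(congr1 (@^~ j)) /=.
  have Fx := pemb_neq0 PR (FR x) j; have Fy := pemb_neq0 PR (FR y) j.
  by move=> h; rewrite -[LHS](divfK Fx) -[_ / _](divfK Fy) h mul1r mulrC.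
Qed.

(** * Coding finite sequences over an infinite set *)

(** Zorn's lemma for graphs of partial injections from [A] to [B]: a maximal one exhausts [A] or
    [B], since otherwise one more pair could be added. *)
Lemma comparable_sets (T : Type) (A B : set T) :
  (exists f : T -> T, (forall x, A x -> B (f x)) /\
     forall x y, A x -> A y -> f x = f y -> x = y) \/
  (exists f : T -> T, (forall x, B x -> A (f x)) /\
     forall x y, B x -> B y -> f x = f y -> x = y).
Proof.
pose P (R : set (T * T)) := [/\ forall x y, R (x, y) -> A x /\ B y,
  forall x y z, R (x, y) -> R (x, z) -> y = z &
  forall x y z, R (x, z) -> R (y, z) -> x = y].
have [|R [[RAB Rfun Rinj] Rmax]] := @Zorn_bigcup _ P.
  move=> C CP Ctot; split.
  - by move=> x y [R CR] Rxy; have [h _ _] := CP _ CR; apply: h Rxy.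
  - move=> x y z [R CR Rxy] [S CS Sxz].
    have [RS|SR] := Ctot _ _ CR CS.
      by have [_ h _] := CP _ CS; apply: h (RS _ Rxy) Sxz.
    by have [_ h _] := CP _ CR; apply: h Rxy (SR _ Sxz).
  - move=> x y z [R CR Rxy] [S CS Sxz].
    have [RS|SR] := Ctot _ _ CR CS.
      by have [_ _ h] := CP _ CS; apply: h (RS _ Rxy) Sxz.
    by have [_ _ h] := CP _ CR; apply: h Rxy (SR _ Sxz).
have [Adom|/existsNP[a /not_implyP[Aa na]]] := pselect (forall a, A a -> exists b, R (a, b)).
  left; have [f fP] : exists f, forall a, A a -> R (a, f a).
    have /choice[f fP] : forall a, exists b, A a -> R (a, b).
      by move=> a; have [/Adom[b]|] := pselect (A a); [exists b|exists a].
    by exists f.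
  exists f; split=> [x /fP/RAB[]//|x y Ax Ay fxy].
  by apply: Rinj (fP _ Ax) _; rewrite fxy; apply: fP.
have [Bdom|/existsNP[b /not_implyP[Bb nb]]] := pselect (forall b, B b -> exists a, R (a, b)).
  right; have [f fP] : exists f, forall b, B b -> R (f b, b).
    have /choice[f fP] : forall b, exists a, B b -> R (a, b).
      by move=> b; have [/Bdom[c]|] := pselect (B b); [exists c|exists b].
    by exists f.
  exists f; split=> [x /fP/RAB[]//|x y Bx By fxy].
  by apply: Rfun (fP _ Bx) _; rewrite fxy; apply: fP.
exfalso; apply: (Rmax (R `|` [set (a, b)])).
  split=> [u Ru|/(_ (a, b)) Rab]; first by left.
  by apply: na; exists b; apply: Rab; right.
split=> [x y [/RAB//|[-> ->]]//|x y z [Rxy|[xa ->]] [Rxz|[xa' ->]]//|x y z [Rxz|[-> zb]] [Ryz|[-> zb']]//].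
- exact: Rfun Rxy Rxz.
- by case: na; exists y; rewrite -xa'.
- by case: na; exists z; rewrite -xa.
- exact: Rinj Rxz Ryz.
- by case: nb; exists x; rewrite -zb'.
- by case: nb; exists y; rewrite -zb.
Qed.

Section FiniteSequences.
Context (T : eqType).
Implicit Types (R : set (seq T * T)) (s : seq T).

Let carrier R := [set x | exists t, R ([:: x], t)].

(** An injection of the nonempty finite sequences over a set into that set. The set is read off from
    the coded singletons, so that Zorn's lemma applies to graphs alone. *)
Record partial_coding R : Prop := PartialCoding {
  pcod_fun : forall s t u, R (s, t) -> R (s, u) -> t = u;
  pcod_inj : forall s r t, R (s, t) -> R (r, t) -> s = r;
  pcod_val : forall s t, R (s, t) -> carrier R t;
  pcod_dom : forall s t, R (s, t) -> forall x, x \in s -> carrier R x;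
  pcod_all : forall x s, (forall y, y \in x :: s -> carrier R y) ->
    exists t, R (x :: s, t) }.

Lemma partial_coding_bigcup (C : set (set (seq T * T))) :
  C `<=` partial_coding -> total_on C subset ->
  partial_coding (\bigcup_(R in C) R).
Proof.
move=> CP Ctot.
have sup R : C R -> R `<=` \bigcup_(R in C) R by move=> CR u Ru; exists R.
have csup R : C R -> carrier R `<=` carrier (\bigcup_(R in C) R).
  by move=> CR x [t Rx]; exists t; apply: sup CR _ Rx.
split.
- move=> s t u [R CR Rs] [S CS Su].
  have [RS|SR] := Ctot _ _ CR CS; first exact: (pcod_fun (CP _ CS)) (RS _ Rs) Su.
  exact: (pcod_fun (CP _ CR)) Rs (SR _ Su).
- move=> s t u [R CR Rs] [S CS Su].
  have [RS|SR] := Ctot _ _ CR CS; first exact: (pcod_inj (CP _ CS)) (RS _ Rs) Su.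
  exact: (pcod_inj (CP _ CR)) Rs (SR _ Su).
- by move=> s t [R CR] /(pcod_val (CP _ CR)); apply: csup.
- by move=> s t [R CR] /(pcod_dom (CP _ CR)) h x /h; apply: csup.
(* The finitely many entries of a sequence lie in the carrier of a single member of the chain. *)
- have cov s x : (forall y, y \in x :: s -> carrier (\bigcup_(R in C) R) y) ->
      exists2 R, C R & forall y, y \in x :: s -> carrier R y.
    elim: s x => [|y s IH] x xs.
      have [|t [R CR Rx]] := xs x; first by rewrite mem_head.
      by exists R => // _ /[!inE] /eqP ->; exists t.
    have [z zs|R CR Rs] := IH y; first by apply: xs; rewrite inE zs orbT.
    have [|t [S CS Sx]] := xs x; first by rewrite mem_head.
    have [RS|SR] := Ctot _ _ CR CS.
      exists S => // z /[1!inE] /predU1P[->|/Rs[u Ru]]; first by exists t.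
      by exists u; apply: RS.
    exists R => // z /[1!inE] /predU1P[->|/Rs//].
    by exists t; apply: SR.
  move=> x s /cov[R CR /(pcod_all (CP _ CR))[t Rt]].
  by exists t; apply: sup CR _ Rt.
Qed.

Lemma partial_coding_fun R : partial_coding R -> forall x0 : T,
  exists e : seq T -> T,
   (forall s, s <> [::] -> (forall x, x \in s -> carrier R x) -> carrier R (e s)) /\
   (forall s r, s <> [::] -> (forall x, x \in s -> carrier R x) ->
     r <> [::] -> (forall x, x \in r -> carrier R x) -> e s = e r -> s = r).
Proof.
move=> PR x0.
have /choice[e eP] : forall s, exists t,
    s <> [::] -> (forall x, x \in s -> carrier R x) -> R (s, t).
  move=> [|x s]; first by exists x0.
  have [/(pcod_all PR)[t Rt]|] := pselect (forall y, y \in x :: s -> carrier R y); first by exists t.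
  by exists x0.
exists e; split=> [s s0 sR|s r s0 sR r0 rR esr].
  exact: (pcod_val PR (eP _ s0 sR)).
apply: (pcod_inj PR (eP _ s0 sR)); rewrite esr; exact: eP.
Qed.

Let doubling (B : set T) (f : T -> T) (x : T) : seq T :=
  if `[< B x >] then [:: x] else [:: f x; f x].

Let doubling_inj (B D : set T) f :
  (forall x y, D x -> D y -> f x = f y -> x = y) ->
  forall x y, B x \/ D x -> B y \/ D y -> doubling B f x = doubling B f y -> x = y.
Proof.
move=> finj x y xD yD; rewrite /doubling.
case: asboolP => Bx; case: asboolP => By // [] //.
by move=> fxy _; apply: finj => //; [case: xD|case: yD].
Qed.

(* Each element of [D] is replaced by a pair of equal elements of the carrier
   [B]; a sequence over [B] and [D] thus becomes a sequence of nonempty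
   sequences over [B], which is encoded by coding twice. *)
Lemma coding_extension R (x0 : T) (f : T -> T) (D : set T) :
  partial_coding R -> (forall x, D x -> carrier R (f x)) ->
  (forall x y, D x -> D y -> f x = f y -> x = y) ->
  exists c : seq T -> T,
    (forall s, s <> [::] -> (forall x, x \in s -> carrier R x \/ D x) -> carrier R (c s)) /\
    (forall s r, s <> [::] -> (forall x, x \in s -> carrier R x \/ D x) ->
      r <> [::] -> (forall x, x \in r -> carrier R x \/ D x) -> c s = c r -> s = r).
Proof.
move=> PR fD finj; have [e [eR einj]] := partial_coding_fun PR x0.
pose h := doubling (carrier R) f.
have h0 x : h x <> [::] by rewrite /h /doubling; case: asboolP.
have hR x : carrier R x \/ D x -> forall y, y \in h x -> carrier R y.
  rewrite /h /doubling; case: asboolP => [Rx _ y|nRx [//|Dx] y]; rewrite !inE.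
    by move=> /eqP ->.
  by rewrite orbb => /eqP ->; apply: fD.
have map0 (s : seq T) : s <> [::] -> map (e \o h) s <> [::] by case: s.
have mapR s : (forall x, x \in s -> carrier R x \/ D x) ->
    forall y, y \in map (e \o h) s -> carrier R y.
  by move=> sR y /mapP[x xs ->]; apply: eR => //; apply: hR; apply: sR.
exists (fun s => e (map (e \o h) s)); split=> [s s0 sR|s r s0 sR r0 rR].
  by apply: eR; [apply: map0|apply: mapR].
move=> /einj esr; have {esr} : map (e \o h) s = map (e \o h) r.
  by apply: esr; [apply: map0|apply: mapR|apply: map0|apply: mapR].
elim: s r sR rR {s0 r0} => [|x s IH] [|y r] //= sR rR [exy esr].
have xR : carrier R x \/ D x by apply: sR; rewrite mem_head.
have yR : carrier R y \/ D y by apply: rR; rewrite mem_head.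
congr (_ :: _).
  apply: (doubling_inj finj xR yR); apply: einj => //; exact: hR.
by apply: IH => // z zs; [apply: sR|apply: rR]; rewrite inE zs orbT.
Qed.

(** The carrier is enlarged by its image [D] under [f]. Sequences over the union with an entry in
    [D] are first coded in the old carrier; [f] then moves these codes into [D], away from the old
    codes. *)
Lemma partial_coding_extend R (f : T -> T) : partial_coding R -> R !=set0 ->
  (forall x, carrier R x -> ~ carrier R (f x)) ->
  (forall x y, carrier R x -> carrier R y -> f x = f y -> x = y) ->
  exists S, R `<` S /\ partial_coding S.
Proof.
move=> PR [[s0 x0] Rsx] fR finj.
have Rx0 : carrier R x0 := pcod_val PR Rsx.
pose D := f @` carrier R.
have /choice[g gP] : forall y, exists x, D y -> carrier R x /\ f x = y.
  by move=> y; have [[x Rx <-]|nD] := pselect (D y); [exists x|exists y].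
have gD y : D y -> carrier R (g y) by case/gP.
have ginj x y : D x -> D y -> g x = g y -> x = y.
  by move=> /gP[_ fx] /gP[_ fy] gxy; rewrite -fx gxy fy.
have [c [cR cinj]] := coding_extension x0 PR gD ginj.
have DR y : D y -> ~ carrier R y by move=> [x Rx <-]; apply: fR.
pose new s := [/\ s <> [::], forall x, x \in s -> carrier R x \/ D x &
  ~ forall x, x \in s -> carrier R x].
pose S := R `|` [set u | new u.1 /\ u.2 = f (c u.1)].
have newR s t : R (s, t) -> ~ new s.
  by move=> Rst [_ _]; apply; apply: pcod_dom Rst.
have newc s : new s -> carrier R (c s) by case=> s0' sRD _; apply: cR.
have valD s t : R (s, t) -> forall r, new r -> t <> f (c r).
  by move=> /(pcod_val PR) Rt r /newc Rc tf; apply: (fR (c r)) => //; rewrite -tf.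
have RS x : carrier R x -> carrier S x by case=> t Rt; exists t; left.
have DS x : D x -> carrier S x.
  move=> Dx; exists (f (c [:: x])); right; split=> //; split=> //.
    by move=> y /[!inE] /eqP ->; right.
  by move=> /(_ x); rewrite mem_head => /(_ isT); apply: DR.
have SRD x : carrier S x -> carrier R x \/ D x.
  move=> [t [Rt|[[_ xRD _] _]]]; first by left; exists t.
  by apply: xRD; rewrite mem_head.
exists S; split.
  split=> [u Ru|SR]; first by left.
  have Dx : D (f x0) by exists x0.
  have [t /SR Rt] := DS _ Dx.
  by apply: (fR x0) => //; exists t.
split.
- move=> s t u [Rst|[/= ns ->]] [Rsu|[/= ns' ->]] //.
  + exact: (pcod_fun PR) Rst Rsu.
  + by case: (newR _ _ Rst).
  + by case: (newR _ _ Rsu).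
- move=> s r t [Rst|[/= ns ts]] [Rrt|[/= nr tr]].
  + exact: (pcod_inj PR) Rst Rrt.
  + by case: (valD _ _ Rst _ nr).
  + by case: (valD _ _ Rrt _ ns).
  + have /finj csr : f (c s) = f (c r) by rewrite -ts tr.
    have {}csr := csr (newc _ ns) (newc _ nr).
    by case: ns nr => s0' sRD _ [r0' rRD _]; apply: cinj.
- move=> s t [/(pcod_val PR)/RS//|[/= ns ->]].
  by apply: DS; exists (c s) => //; apply: newc.
- move=> s t [Rst x xs|[/= [_ sRD _] _ x /sRD[/RS|/DS]//]].
  by apply: RS; apply: (pcod_dom PR Rst).
- move=> x s xsS.
  have [/(pcod_all PR)[t Rt]|nR] := pselect (forall y, y \in x :: s -> carrier R y).
    by exists t; left.
  exists (f (c (x :: s))); right; split=> //; split=> // y /xsS; exact: SRD.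
Qed.

End FiniteSequences.

(** Let [B] be the carrier of a maximal partial coding. If [B] injected into its complement, the
    coding could be extended; so the complement injects into [B], and all sequences over [T] can be
    coded in [B]. *)
Lemma seq_injection (T : choiceType) : infinite_set [set: T] ->
  exists c : seq T -> T, injective c.
Proof.
move=> /infiniteP /card_leP [g0].
pose g (n : nat) : T := set_val (g0 (to_setT n)).
have ginj : injective g.
  move=> m n /val_inj gmn.
  suff : to_setT m = to_setT n by move=> /(congr1 set_val).
  by apply: (inj (f := g0)) gmn; rewrite inE.
have [R [PR Rmax]] := Zorn_bigcup (@partial_coding_bigcup T).
have [u0 Ru0] : R !=set0.
  apply: contrapT => R0.
  pose N : set (seq T * T) := [set (map g ns, g (choice.pickle ns)) | ns in [set: seq nat]].
  have Ng n : exists t, N ([:: g n], t) by exists (g (choice.pickle [:: n])), [:: n].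
  have gN s t : N (s, t) -> forall x, x \in s -> exists n, x = g n.
    by move=> [ns _ [<- _]] x /mapP[n _ ->]; exists n.
  apply: (Rmax N).
    split=> [u Ru|NR]; first by case: R0; exists u.
    by apply: R0; exists ([::], g (choice.pickle (Nil nat))); apply: NR; exists [::].
  split.
  - by move=> s t u [ns _ [<- <-]] [ms _ [/(inj_map ginj) -> <-]].
  - move=> s r t [ns _ [<- <-]] [ms _ [<- /ginj e]].
    by rewrite (pcan_inj choice.pickleK e).
  - by move=> s t [ns _ [_ <-]]; apply: Ng.
  - by move=> s t /gN h x /h[n ->]; apply: Ng.
  - move=> x s xs.
    have [ns nsE] : exists ns, map g ns = x :: s.
      elim: (x :: s) xs => [|y r IH] yr; first by exists [::].
      have [z zr|ns nsr] := IH; first by apply: yr; rewrite inE zr orbT.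
      have [|t /gN/(_ y)] := yr y; first by rewrite mem_head.
      by rewrite mem_head => /(_ isT)[n ->]; exists (n :: ns); rewrite /= nsr.
    by exists (g (choice.pickle ns)), ns => //; rewrite nsE.
pose B := [set x | exists t, R ([:: x], t)].
have [[f [fB finj]]|[f [fB finj]]] := comparable_sets (~` B) B.
  have [c [_ cinj]] := coding_extension u0.2 PR fB finj.
  have BD (s : seq T) x : x \in s -> B x \/ (~` B) x by have [|] := pselect (B x); [left|right].
  (* Prepending a fixed element makes every sequence nonempty, as [c] requires. *)
  exists (fun s => c (u0.2 :: s)) => s r csr.
  suff : u0.2 :: s = u0.2 :: r by case.
  by apply: cinj => // x; apply: BD.
have [|S [RS PS]] := partial_coding_extend PR _ fB finj; first by exists u0.
by case: (Rmax S).
Qed.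

(** * Distinguished coordinates and paddings *)

Section Coordinates.
Context (T I : choiceType) (F : T -> I -> algC).
Context (F_inj : injective F) (F_fin : forall x, finite_set [set j | F x j != 1]).
Implicit Types (X : set T).

Definition supp (x : T) : {fset I} := fset_set [set j | F x j != 1].

Lemma in_supp x j : (j \in supp x) = (F x j != 1).
Proof. by rewrite in_fset_set //; apply/idP/idP => [/set_mem|h]; last exact: mem_set. Qed.

(* A coordinate is determined by the first element of [X] in whose support it
   lies, together with its position in that support. *)
Lemma traces_inj (Z : eqType) (X : set T) (first : I -> T) (g : T -> Z) :
  (forall x j, X x -> F x j != 1 -> F (first j) j != 1) ->
  (forall x y i j, X x -> X y -> F x i != 1 -> F y j != 1 ->
     g (first i) = g (first j) -> first i = first j) ->
  {in X &, injective (fun x =>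
    [seq (g (first j), index j (supp (first j)), F x j) | j <- supp x])}.
Proof.
move=> firstX ginj.
have key x y : X x -> X y ->
    [seq (g (first j), index j (supp (first j)), F x j) | j <- supp x] =
    [seq (g (first j), index j (supp (first j)), F y j) | j <- supp y] ->
    forall i, F x i != 1 -> F y i = F x i.
  move=> Xx Xy e i Fxi.
  have : (g (first i), index i (supp (first i)), F x i) \in
      [seq (g (first j), index j (supp (first j)), F x j) | j <- supp x].
    by apply/mapP; exists i => //; rewrite in_supp.
  rewrite e => /mapP[j]; rewrite in_supp => Fyj [gij ij Fij].
  have fij := ginj _ _ _ _ Xx Xy Fxi Fyj gij.
  suff eq_ij : i = j by rewrite Fij eq_ij.
  have iS : i \in supp (first i) by rewrite in_supp (firstX x).
  have jS : j \in supp (first i) by rewrite fij in_supp (firstX y).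
  by rewrite -(nth_index i iS) ij -fij nth_index.
move=> x y /[!inE] Xx Xy e; apply: F_inj; apply/funext => i.
have [Fx|/(key x y Xx Xy e i)->//] := eqVneq (F x i) 1.
by have [->//|/(key y x Xy Xx (esym e) i)] := eqVneq (F y i) 1.
Qed.

(** [A] has one coordinate for each member of [Y], the set of those [x] in [X] that bring in a
    coordinate of no earlier member. By its trace, each [x] is determined by a finite sequence over
    the product of [Y] and a countable set. So [Y] is infinite, as [X] would be countable otherwise,
    and then has the size of [X]. *)
Lemma first_coordinates X : ~ countable X ->
  exists (A : set I) (r : rel T) (first : I -> T), [/\ A #= X,
    antisymmetric r /\ (forall s : seq T, s <> [::] -> exists2 x, x \in s & forall y, y \in s -> r x y),
    forall j, A j -> X (first j) /\ F (first j) j != 1,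
    forall j x, A j -> X x -> F x j != 1 -> r (first j) x &
    forall i j, A i -> A j -> first i = first j -> i = j].
Proof.
move=> Xunc; have [r rwo] := well_ordering_principle T.
have /set0P[x0 Xx0] : X != set0 by apply/eqP => X0; apply: Xunc; rewrite X0.
pose A0 := [set j | exists2 x, X x & F x j != 1].
have /choice[first firstP] : forall j, exists x, A0 j ->
    [/\ X x, F x j != 1 & forall y, X y -> F y j != 1 -> r x y].
  move=> j; have [[x Xx Fx]|] := pselect (A0 j); last by exists x0.
  have [|y [[/asboolP[Xy Fy] ymin] _]] := rwo [pred x | `[< X x /\ F x j != 1 >]].
    by exists x; apply/asboolP.
  by exists y => _; split=> // z Xz Fz; apply: ymin; apply/asboolP.
pose Y := first @` A0.
have YX : Y `<=` X by move=> _ [j /firstP[]] ? ? ? <-.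
have /choice[rho rhoP] : forall x, exists j, Y x -> A0 j /\ first j = x.
  move=> x; have [[j A0j <-]|nY] := pselect (Y x); first by exists j.
  have [j _] : exists j : I, True.
    apply: contrapT => nI; apply: Xunc; apply: (sub_countable _ (countable1 x0)).
    apply: subset_card_le => y _; apply: F_inj; apply/funext => j.
    by case: nI; exists j.
  by exists j.
have firstX x j : X x -> F x j != 1 -> F (first j) j != 1.
  by move=> Xx Fx; have [|] := firstP j; first by exists x.
have firstY x j : X x -> F x j != 1 -> Y (first j).
  by move=> Xx Fx; exists j => //; exists x.
exists (rho @` Y), r, first; split.
- have YeqX : Y #= X.
    apply: Cantor_Bernstein; first exact: subset_card_le.
    have Yinf : infinite_set Y.
      move=> /finite_set_countable /countable_injP[g ginj]; apply: Xunc.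
      have tinj := traces_inj firstX (fun x y i j Xx Xy Fx Fy =>
        ginj _ _ (mem_set (firstY x i Xx Fx)) (mem_set (firstY y j Xy Fy))).
      apply/countable_injP; exists (fun x => choice.pickle
        [seq (g (first j), index j (supp (first j)), F x j) | j <- supp x]).
      by move=> x y Xx Xy /(pcan_inj choice.pickleK); apply: tinj.
    have [|c cinj] := @seq_injection (set_type Y).
      by rewrite (eq_finite_set (card_setT Y)).
    have [y0 Yy0] := infinite_setN0 Yinf.
    have /choice[g gK] : forall t, exists y : set_type Y, Y t -> set_val y = t.
      move=> t; have [Yt|nYt] := pselect (Y t); first by exists (SigSub (mem_set Yt)).
      by exists (SigSub (mem_set Yy0)).
    have ginj x y i j : X x -> X y -> F x i != 1 -> F y j != 1 ->
        g (first i) = g (first j) -> first i = first j.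
      move=> Xx Xy Fx Fy gij.
      by rewrite -(gK _ (firstY _ _ Xx Fx)) gij (gK _ (firstY _ _ Xy Fy)).
    have tinj := traces_inj firstX ginj.
    (* A triple becomes a sequence over [Y]: the length encodes the two countable components, and
       the added one keeps the entry itself readable. *)
    pose k (v : set_type Y * nat * algC) := c (nseq (choice.pickle (v.1.2, v.2)).+1 v.1.1).
    have kinj : injective k.
      move=> [[y n] v] [[y' n'] v'] /cinj /= e.
      have := congr1 size e; rewrite /= !size_nseq => -[/(pcan_inj choice.pickleK) [-> ->]].
      by case: e => ->.
    pose f x := set_val (c (map k [seq (g (first j), index j (supp (first j)), F x j) | j <- supp x])).
    have finj : {in X &, injective f}.
      by move=> x y Xx Xy /val_inj /cinj /(inj_map kinj); apply: tinj.
    have fY : f @` X `<=` Y by move=> _ [x _ <-]; apply: set_valP.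
    by rewrite -(card_le_eql (inj_card_eq finj)); apply: subset_card_le.
  apply: card_eq_trans YeqX; apply: inj_card_eq => x y /[!inE] Yx Yy e.
  by have [_ <-] := rhoP _ Yx; rewrite e; have [_ ->] := rhoP _ Yy.
- split=> [x y rxy|s s0].
    by apply: (wo_chain_antisymmetric (C := predT)) rxy => // D _; apply: rwo.
  have [|x [[xs xmin] _]] := rwo [mem s]; last by exists x.
  by case: s s0 => // x s _; exists x; apply: mem_head.
- move=> _ [x Yx <-]; have [A0x _] := rhoP _ Yx.
  by have [] := firstP _ A0x.
- move=> _ y [x Yx <-] Xy Fy; have [A0x _] := rhoP _ Yx.
  by have [_ _] := firstP _ A0x; apply.
- move=> _ _ [x Yx <-] [y Yy <-].
  by have [_ ->] := rhoP _ Yx; have [_ ->] := rhoP _ Yy => ->.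
Qed.

(** Induction on the size of [a], removing the [i] with least [first i]. If [i] is missing from the
    support of the sum for the rest, [first i] is added. This changes no other coordinate [j] of
    [a]: if [j] were in the support of [first i], then [first j] would not come later, forcing
    [j = i]. *)
Lemma triangular_sums X (A : set I) (r : rel T) (first : I -> T) :
  antisymmetric r ->
  (forall s : seq T, s <> [::] -> exists2 x, x \in s & forall y, y \in s -> r x y) ->
  (forall j, A j -> X (first j) /\ F (first j) j != 1) ->
  (forall j x, A j -> X x -> F x j != 1 -> r (first j) x) ->
  (forall i j, A i -> A j -> first i = first j -> i = j) ->
  forall a : {fset I}, [set` a] `<=` A ->
  exists b : seq T, [/\ uniq b, forall x, x \in b -> X x &
    forall j, j \in a -> \prod_(x <- b) F x j != 1].
Proof.
move=> ranti rmin firstX firstmin firstinj.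
suff H n (a : seq I) : (size a <= n)%N -> uniq a -> (forall j, j \in a -> A j) ->
    exists b : seq T, [/\ uniq b, forall x, x \in b -> exists2 j, j \in a & x = first j &
      forall j, j \in a -> \prod_(x <- b) F x j != 1].
  move=> a aA; have [b [bu bX bP]] := H (size a) a (leqnn _) (fset_uniq a) aA.
  by exists b; split=> // x /bX[j /aA/firstX[Xj _] ->].
elim: n a => [|n IH] a.
  by rewrite leqn0 => /nilP -> _ _; exists [::]; split.
case: a => [|i0 a0]; first by exists [::].
move: (i0 :: a0) (mem_head i0 a0) => a ia an ua aA.
have [|x /mapP[i ai ->] imin] := rmin (map first a); first by case: (a) ia.
have [|||b [bu bA bP]] := IH (rem i a).
- by rewrite size_rem //; case: (size a) an.
- exact: rem_uniq.
- by move=> j /mem_rem/aA.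
have nbi : first i \notin b.
  apply/negP => /bA[j]; rewrite mem_rem_uniq // inE => /andP[ji ja] e.
  by move: ji; rewrite (firstinj i j) ?eqxx //; apply: aA.
have remP j : j \in a -> j != i -> j \in rem i a.
  by move=> ja ji; rewrite mem_rem_uniq // inE ji.
have bA' x0 : x0 \in b -> exists2 j, j \in a & x0 = first j.
  by move=> /bA[j /mem_rem ja ->]; exists j.
have [bi|bi] := eqVneq (\prod_(x <- b) F x i) 1; last first.
  exists b; split=> // j ja.
  by have [->//|ji] := eqVneq j i; apply: bP; apply: remP.
exists (first i :: b); split=> [|y|j ja].
- by rewrite /= nbi.
- by rewrite inE => /predU1P[->|/bA'//]; exists i.
rewrite big_cons; have [->|ji] := eqVneq j i.
  by rewrite bi mulr1; have [] := firstX i (aA _ ai).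
have [->|Fj] := eqVneq (F (first i) j) 1; first by rewrite mul1r; apply/bP/remP.
have [Xi _] := firstX i (aA _ ai).
have rji := firstmin j (first i) (aA _ ja) Xi Fj.
have rij : r (first i) (first j) by apply: imin; apply: map_f.
have /firstinj e : first i = first j by apply: ranti; rewrite rij.
by move: ji; rewrite e ?eqxx //; apply: aA.
Qed.


(** * Uncountable subfamilies with uniform supports *)

Lemma uncountable_fiber (Z : countType) X (L : T -> Z) :
  ~ countable X -> exists l, ~ countable [set x | X x /\ L x = l].
Proof.
move=> Xunc; apply: contrapT => /forallNP nL; apply: Xunc.
rewrite (_ : X = \bigcup_(l in [set: Z]) [set x | X x /\ L x = l]).
  by apply: bigcup_countable; [exact: countableP|move=> l _; apply: contrapT; apply: nL].
by apply/seteqP; split=> [x Xx|x [l _ []//]]; exists (L x).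
Qed.

(* The common part [g] is chosen with a support of maximal size among those
   agreed upon by uncountably many members. *)
Lemma uncountable_common_part X k : ~ countable X ->
  (forall x, X x -> (#|` supp x| <= k)%N) ->
  exists g : I -> algC, finite_set [set j | g j != 1] /\
    forall E : {fset I}, ~ countable [set x | X x /\ forall j, j \in E -> F x j = g j].
Proof.
move=> Xunc Xk.
pose P n := exists (g : I -> algC) (u : {fset I}), [/\ #|` u| = n,
  forall j, (j \in u) = (g j != 1) &
  ~ countable [set x | X x /\ forall j, j \in u -> F x j = g j]].
have P0 : exists n, `[< P n >].
  exists 0%N; apply/asboolP; exists (fun=> 1), fset0; split=> //.
    by move=> j; rewrite eqxx.
  by rewrite (_ : [set _ | _] = X) //; apply/seteqP; split=> x //= [].
have Pk n : `[< P n >] -> (n <= k)%N.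
  move=> /asboolP[g [u [<- ug unc]]].
  have /set0P[x [Xx xg]] : [set x | X x /\ forall j, j \in u -> F x j = g j] != set0.
    by apply/eqP => e; apply: unc; rewrite e.
  apply: leq_trans (Xk _ Xx); apply: fsubset_leq_card; apply/fsubsetP => j ju.
  by rewrite in_supp xg // -ug.
case: (ex_maxnP P0 Pk) => n /asboolP[g [u [un ug unc]]] nmax.
exists g; split.
  by apply: sub_finite_set (finite_fset u) => j /=; rewrite ug.
move=> E cE; apply: unc.
pose Xu := [set x | X x /\ forall j, j \in u -> F x j = g j].
(* If uncountably many members of [Xu] shared a value [c] other than 1 at some [j] outside [u], then
   [u] could be enlarged by [j], against maximality. So only countably many members of [Xu] disagree
   with [g] on [E]. *)
pose bad j c := [set x | [/\ Xu x, j \notin u, c != 1 & F x j = c]].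
have badc j c : countable (bad j c).
  apply: contrapT => nc.
  have [ju|ju] := boolP (j \in u).
    by apply: nc; rewrite (_ : bad j c = set0) //; apply/seteqP; split=> x //= [] _; rewrite ju.
  have [c1|c1] := eqVneq c 1.
    by apply: nc; rewrite (_ : bad j c = set0) //; apply/seteqP; split=> x //= [] _ _; rewrite c1 eqxx.
  have : (n.+1 <= n)%N.
    apply: nmax; apply/asboolP; exists (fun i => if i == j then c else g i), (j |` u)%fset; split.
    - by rewrite cardfsU1 ju un.
    - by move=> i; rewrite !inE; case: eqVneq => [->|_] //=; rewrite ?ug ?c1.
    - apply: contra_not nc; apply: sub_countable; apply: subset_card_le.
      move=> x [[Xx xu] _ _ Fx]; split=> // i; rewrite !inE.
      by case: eqVneq => [-> _|_ /= /xu].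
  by rewrite ltnn.
apply: (@sub_countable _ _ _ ([set x | X x /\ forall j, j \in E -> F x j = g j] `|`
   \bigcup_(j in [set` E]) \bigcup_(c in [set: algC]) bad j c)).
  apply: subset_card_le => x [Xx xu].
  have [xE|/existsNP[j /not_implyP[jE xj]]] := pselect (forall j, j \in E -> F x j = g j); first by left.
  have ju : j \notin u by apply/negP => /xu.
  right; exists j => //; exists (F x j) => //; split=> //.
  by apply/eqP => Fx1; apply: xj; rewrite Fx1; move: ju; rewrite ug negbK => /eqP.
rewrite -bigcup2E; apply: bigcup_countable; first exact: countableP.
move=> [|[|m]] _ //=.
apply: bigcup_countable; first exact: countable_fset.
by move=> j _; apply: bigcup_countable; first exact: countableP.
Qed.

Lemma count_fsetU_disjoint (A B : {fset I}) (p : pred I) :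
  (forall j, j \in A -> j \notin B) ->
  count p (A `|` B)%fset = (count p A + count p B)%N.
Proof.
move=> AB; rewrite -count_cat; apply/permP/uniq_perm.
- exact: fset_uniq.
- rewrite cat_uniq !fset_uniq /= andbT -all_predC; apply/allP => j jB /=.
  by apply/negP => /AB; rewrite jB.
- by move=> j; rewrite mem_cat !inE.
Qed.

(* Outside [E] the chosen elements have pairwise disjoint supports, so the number
   of new coordinates satisfying [p] is linear in [m]. *)
Lemma paddings X (g : I -> algC) (E : {fset I}) (b : seq T) (q : (I -> bool) -> nat) (Q : set (I -> bool)) :
  (forall E : {fset I}, ~ countable [set x | X x /\ forall j, j \in E -> F x j = g j]) ->
  (forall j, g j != 1 -> j \in E) ->
  (forall p x, Q p -> X x -> (forall j, j \in E -> F x j = g j) ->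
     count p (supp x `\` E)%fset = q p) ->
  forall m, exists (ys : seq T) (U : {fset I}), [/\ size ys = m /\ uniq ys,
    forall y, y \in ys -> X y /\ y \notin b,
    forall j, j \in E -> \prod_(y <- ys) F y j = g j ^+ m,
    forall j, j \notin E -> (\prod_(y <- ys) F y j != 1) = (j \in U) &
    (forall j, j \in U -> j \notin E) /\ forall p, Q p -> count p U = (m * q p)%N].
Proof.
move=> unc gE Qq; elim=> [|m [ys [U [[szys uys] ysX ysE ysU [UE UQ]]]]].
  exists [::], fset0; split=> //.
  - by move=> j jE; rewrite big_nil.
  - by move=> j jE; rewrite big_nil eqxx.
(* Agreement with [g] on [U] too, where [g] is 1, keeps the support of the next [y] away from the
   coordinates in [U]. *)
pose E' := (E `|` U)%fset.
have [y [Xy yE] yb] : exists2 y, X y /\ (forall j, j \in E' -> F y j = g j) & y \notin b ++ ys.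
  apply: contrapT => h; apply: (unc E').
  apply: (sub_countable (subset_card_le _) (finite_set_countable (finite_seq (b ++ ys)))) => y yP.
  by apply: contrapT => yb; apply: h; exists y => //; apply/negP.
have yEg j : j \in E -> F y j = g j by move=> jE; apply: yE; rewrite inE jE.
have yU j : j \in U -> F y j = 1.
  move=> jU; rewrite yE; last by rewrite inE jU orbT.
  by apply: contrapT => /eqP /gE; apply/negP; apply: UE.
exists (y :: ys), ((supp y `\` E) `|` U)%fset; split.
- by rewrite /= szys uys andbT; split=> //; move: yb; rewrite mem_cat negb_or => /andP[].
- move=> z /[1!inE] /predU1P[->|/ysX//]; split=> //.
  by move: yb; rewrite mem_cat negb_or => /andP[].
- by move=> j jE; rewrite big_cons exprS ysE // yEg.
- move=> j jE; rewrite big_cons !inE in_supp jE /=.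
  have [jU|jU] := boolP (j \in U).
    by rewrite yU // mul1r orbT ysU.
  have /eqP -> : \prod_(y0 <- ys) F y0 j == 1 by apply/negPn; rewrite ysU.
  by rewrite mulr1 orbF.
- split=> [j|p Qp]; first by rewrite !inE => /orP[/andP[]//|/UE].
  rewrite count_fsetU_disjoint ?UQ ?(Qq p y) // => j.
  by rewrite !inE in_supp => /andP[_]; apply: contra => /yU ->.
Qed.


End Coordinates.

(** * Decoding *)

(** Numbers [j] of 2-adic valuation [c] can be arbitrarily large, and a progression of step less
    than [2 ^ j] that starts below [2 ^ j] meets the interval from [2 ^ j] to [2 ^ j.+1], on which
    the logarithm is [j]. *)
Lemma log_code (c Q p k m0 : nat) : (0 < Q)%N -> (0 < k)%N ->
  exists m, [/\ (m0 <= m)%N, (Q %| m)%N & logn 2 (trunc_log 2 (p + m * k)) = c].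
Proof.
move=> Q0 k0; pose s := (Q * k)%N; have s0 : (0 < s)%N by rewrite muln_gt0 Q0.
(* [l] dominates [p], [s] and the start of the admissible range; the odd factor [l.*2.+1] makes [j]
   at least [l] without changing its valuation. *)
pose l := (p + s * m0.+1)%N; pose j := (2 ^ c * l.*2.+1)%N.
have lj : (l <= j)%N.
  rewrite /j -[leqLHS]mul1n leq_mul ?expn_gt0 //.
  by rewrite -addnn -addSn leq_addl.
have j2 : (l < 2 ^ j)%N by apply: leq_ltn_trans lj _; apply: ltn_expl.
have pj : (p <= 2 ^ j)%N by apply: ltnW; apply: leq_ltn_trans j2; apply: leq_addr.
have sj : (s < 2 ^ j)%N.
  by apply: leq_ltn_trans j2; rewrite /l mulnS addnCA leq_addr.
pose t := ((2 ^ j - p) %/ s).+1.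
have m0t : (m0 < t)%N.
  rewrite ltnS leq_divRL // leq_subRL // mulnC; apply: ltnW; apply: leq_ltn_trans j2.
  by rewrite leq_add2l leq_mul.
exists (t * Q)%N; split.
- by apply: leq_trans (ltnW m0t) _; apply: leq_pmulr.
- exact: dvdn_mull.
rewrite (@trunc_log_eq 2 j) //; last first.
  rewrite -mulnA -/s /t; apply/andP; split.
    by rewrite -[leqLHS](subnKC pj) leq_add2l ltnW // ltn_ceil.
  rewrite expnS mul2n -addnn mulSn addnCA -addSn leq_add //.
  by rewrite -[leqRHS](subnKC pj) leq_add2l leq_trunc_div.
rewrite /j lognM ?expn_gt0 // pfactorK // (_ : logn 2 l.*2.+1 = 0%N) ?addn0 //.
by rewrite lognE /= dvdn2 /= odd_double.
Qed.

(** If [v] is a root of unity, [Q] is an exponent that kills it and [B] is [u != 1]. Otherwise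
    [u * v ^+ m = 1] for at most one [m], and [B] is true beyond it. *)
Lemma power_eventually (u v : algC) : v != 0 ->
  exists (Q m0 : nat) (B : bool), [/\ (0 < Q)%N, u != 1 -> B &
    forall m, (m0 <= m)%N -> (Q %| m)%N -> (u * v ^+ m != 1) = B].
Proof.
move=> v0; have [[n n0 vn]|nroot] := pselect (exists2 n, (0 < n)%N & v ^+ n = 1).
  exists n, 0%N, (u != 1); split=> // m _ /dvdnP[q ->].
  by rewrite mulnC exprM vn expr1n mulr1.
have [[m1 um1]|nm] := pselect (exists m1, u * v ^+ m1 = 1); last first.
  exists 1%N, 0%N, true; split=> // m _ _; apply/eqP => um; apply: nm; by exists m.
exists 1%N, m1.+1, true; split=> // m m1m _; apply/eqP => um; apply: nroot.
exists (m - m1)%N; first by rewrite subn_gt0.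
by rewrite -(subnKC (ltnW m1m)) exprD mulrA um1 mul1r in um.
Qed.

Lemma powers_eventually (I : eqType) (s : seq I) (u v : I -> algC) :
  (forall i, v i != 0) ->
  exists (Q m0 : nat) (B : I -> bool), [/\ (0 < Q)%N, forall i, u i != 1 -> B i &
    forall m i, (m0 <= m)%N -> (Q %| m)%N -> i \in s -> (u i * v i ^+ m != 1) = B i].
Proof.
move=> v0.
have /choice[f fP] i : exists t : nat * nat * bool, [/\ (0 < t.1.1)%N, u i != 1 -> t.2 &
    forall m, (t.1.2 <= m)%N -> (t.1.1 %| m)%N -> (u i * v i ^+ m != 1) = t.2].
  by have [Q [m0 [B h]]] := power_eventually (u i) (v0 i); exists (Q, m0, B).
exists (\prod_(i <- s) (f i).1.1)%N, (\sum_(i <- s) (f i).1.2)%N, (fun i => (f i).2).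
split=> [|i|m i sm sQ si].
- by apply: prodn_gt0 => i; have [] := fP i.
- by have [_ h _] := fP i.
have [_ _ h] := fP i; apply: h.
  by apply: leq_trans sm; rewrite (big_rem i) //= leq_addr.
by apply: dvdn_trans sQ; rewrite (big_rem i) //= dvdn_mulr.
Qed.

Lemma total_order_exists (I : eqType) :
  exists le : rel I, [/\ total le, antisymmetric le & transitive le].
Proof.
have [r rwo] := well_ordering_principle I.
have wo : wo_chain r predT by move=> D _; apply: rwo.
have rtot x y : r x y || r y x by apply: (wo_chainW wo).
have ranti : antisymmetric r by move=> x y; apply: (wo_chain_antisymmetric wo).
exists r; split=> // y x z rxy ryz.
have [|w [[]]] := rwo [mem [:: x; y; z]]; first by exists x; apply: mem_head.
rewrite !inE => /or3P[]/eqP-> wmin _.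
- by apply: wmin; rewrite !inE eqxx !orbT.
- have ryx : r y x by apply: wmin; rewrite !inE eqxx.
  by rewrite (ranti x y) ?rxy.
- have rzy : r z y by apply: wmin; rewrite !inE eqxx orbT.
  by rewrite -(ranti y z) ?ryz.
Qed.

(** * Ranks in a linear order and the decoding map *)

Section Decoding.
Context (I : choiceType) (le : rel I).
Context (le_total : total le) (le_anti : antisymmetric le) (le_trans : transitive le).

(** Also used for [i] outside [u]. Being a count, it is additive over disjoint unions, so paddings
    shift it linearly. *)
Definition rank (u : {fset I}) (i : I) : nat := count (le^~ i) u.

Lemma rank_inj (u : {fset I}) : {in u &, injective (rank u)}.
Proof.
have H i j : i \in u -> j \in u -> le i j -> rank u i = rank u j -> i = j.
  move=> iu ju lij eij; apply: le_anti; rewrite lij /=.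
  have : all (le^~ i) (filter (le^~ j) u).
    rewrite all_count count_filter size_filter -/(rank u j) -eij; apply/eqP/eq_count => k /=.
    by apply/andb_idr => lki; apply: le_trans lki lij.
  move=> /allP/(_ j); apply; rewrite mem_filter ju andbT.
  by have := le_total j j; rewrite orbb.
move=> i j iu ju eij; have [lij|lji] := orP (le_total i j); first exact: H.
by apply/esym; apply: H.
Qed.

(* The logarithm of the size of [u] is constant on long intervals, so its
   2-adic valuation can be given any value by adding paddings; this is the
   channel through which the positions to be kept are transmitted. *)
Definition decode (u : {fset I}) : {fset I} :=
  let: (p, k, v) := odflt (0%N, 0%N, [::])
    (choice.unpickle (logn 2 (trunc_log 2 #|` u|)) : option (nat * nat * seq (nat * nat))) in
  [fset i in u | rank u i \in [seq (w.1 + (#|` u| - p) %/ k * w.2)%N | w <- v]]%fset.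

(** The list is [b] followed by [m] paddings. On a finite set [E] the support stabilises at a set
    [D] containing [a]; outside [E] each padding adds fixed numbers of coordinates, in total and
    below each [t] in [a]. Then [log_code] supplies an [m] for which the size transmits the code. *)
Lemma decodable_sum (T : choiceType) (F : T -> I -> algC)
    (F_inj : injective F) (F_neq0 : forall x j, F x j != 0)
    (F_fin : forall x, finite_set [set j | F x j != 1])
    (X : set T) (a : {fset I}) (b : seq T) :
  ~ countable X -> uniq b -> (forall x, x \in b -> X x) ->
  (forall j, j \in a -> \prod_(x <- b) F x j != 1) ->
  exists l : seq T, [/\ l <> [::], uniq l, forall x, x \in l -> X x &
    forall u : {fset I}, (forall j, (j \in u) = (\prod_(x <- l) F x j != 1)) ->
      decode u = a].
Proof.
move=> Xunc ub bX ba.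
pose S := supp F; have inS := in_supp F_fin.
(* There are countably many labels, so uncountably many members share the size of the support and
   its ranks at [a]. *)
pose L x := ([seq rank (S x) t | t <- a], #|` S x|).
have [[rs k0] X'unc] := uncountable_fiber L Xunc.
pose X' := [set x | X x /\ L x = (rs, k0)].
have X'k x : X' x -> (#|` S x| <= k0)%N by case=> _ [_ ->].
have [g [gfin gunc]] := uncountable_common_part F_fin X'unc X'k.
have g0 j : g j != 0.
  have /set0P[x [_ xj]] : [set x | X' x /\ forall i, i \in [fset j]%fset -> F x i = g i] != set0.
    by apply/eqP => e; apply: (gunc [fset j]%fset); rewrite e.
  by rewrite -xj ?F_neq0 // inE.
pose Ug := fset_set [set j | g j != 1].
have inUg j : (j \in Ug) = (g j != 1).
  by rewrite in_fset_set //; apply/idP/idP => [/set_mem|h]; last exact: mem_set.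
pose h j := \prod_(x <- b) F x j.
have [Ub inUb] : exists Ub : {fset I}, forall j, h j != 1 -> j \in Ub.
  rewrite /h; elim: (b) => [|x s [Ub IH]].
    by exists fset0 => j; rewrite big_nil eqxx.
  exists (S x `|` Ub)%fset => j; rewrite big_cons inE inS => hj.
  have [Fx|//] := eqVneq (F x j) 1.
  by apply: IH; rewrite Fx mul1r in hj.
pose E := (Ug `|` Ub)%fset.
have gE j : g j != 1 -> j \in E by rewrite -inUg inE => ->.
have hE j : j \notin E -> h j = 1.
  by move=> jE; apply/eqP; apply: contraNT jE => /inUb jU; rewrite inE jU orbT.
clearbody E.
pose agree x := X' x /\ forall j, j \in E -> F x j = g j.
have [y0 y0P] : exists y, agree y.
  apply: contrapT => /forallNP n; apply: (gunc E).
  by rewrite (_ : [set _ | _] = set0) //; apply/seteqP; split=> x // /n.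
pose q (p : I -> bool) := count p (S y0 `\` E)%fset.
pose P := [set p : I -> bool | p = xpredT \/ exists2 t, t \in a & p = le^~ t].
have countS p x : agree x -> count p (S x) = (count p Ug + count p (S x `\` E)%fset)%N.
  move=> [_ xE]; rewrite -count_fsetU_disjoint.
    congr (count p (enum_fset _)); apply/fsetP => j; rewrite !inE inUg inS.
    have [jE|jE] := boolP (j \in E) => /=; first by rewrite xE // orbF.
    by have [_|/gE] := eqVneq (g j) 1; last by rewrite (negPf jE).
  by move=> j; rewrite inUg !inE => /gE ->.
have Pq p x : P p -> X' x -> (forall j, j \in E -> F x j = g j) ->
    count p (S x `\` E)%fset = q p.
  (* The label fixes the count over the whole support and [g] fixes the count on the common part,
     hence the difference is fixed. *)
  move=> Pp Xx xE; apply: (@addnI (count p Ug)).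
  rewrite -countS // -countS //.
  have [_ [ranks sizes]] := Xx; have [[_ [ranks0 sizes0]] _] := y0P.
  case: Pp => [->|[t ta ->]].
    by rewrite !count_predT; move: sizes; rewrite -sizes0.
  by move: ranks; rewrite -ranks0 => /eq_in_map /(_ t ta).
(* Otherwise every agreeing member would have the coordinates [g], so there would be only one. *)
have k_gt0 : (0 < q xpredT)%N.
  rewrite lt0n; apply/eqP => k0'; apply: (gunc E).
  have agree_g x : agree x -> F x = g.
    move=> [Xx xE]; apply/funext => j.
    have [/xE//|jE] := boolP (j \in E).
    have /eqP -> : g j == 1 by apply: contraNT jE => /gE.
    apply/eqP; rewrite -[_ == _]negbK; apply/negP; rewrite -inS => jS.
    have := Pq _ _ (or_introl erefl) Xx xE; rewrite k0' count_predT => /eqP.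
    rewrite -/(#|` _|) cardfs_eq0 => /eqP/fsetP/(_ j).
    by rewrite !inE jS jE.
  apply: (sub_countable (subset_card_le _) (countable1 y0)) => x xP /=.
  by apply: F_inj; rewrite (agree_g _ xP) (agree_g _ y0P).
have [Q [m0 [B [Q0 hB QB]]]] := powers_eventually E h g0.
pose D := [fset j in E | B j]%fset.
(* Recorded are the size of [D], its growth per padding, and for each [t] in [a] its rank in [D] and
   the growth of that rank. From the final size [decode] recovers [m], and from [m] the final
   ranks. *)
pose code := choice.pickle (#|` D|, q xpredT, [seq (rank D t, q (le^~ t)) | t <- a]).
(* The bound [m0.+1] makes [m] positive, so the list is nonempty even when [b] is empty. *)
have [m [m0m Qm mcode]] := log_code code #|` D| m0.+1 Q0 k_gt0.
have [ys [U [[szys uys] ysX ysE ysU [UE UP]]]] :=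
  paddings F_fin b gunc gE Pq m.
exists (b ++ ys); split.
- by case: ys szys {uys ysX ysE ysU} => [m_eq0|y ys _]; [rewrite -m_eq0 in m0m|case: (b)].
- rewrite cat_uniq ub uys andbT /= -all_predC; apply/allP => y /ysX[_] /=; exact.
- by move=> x; rewrite mem_cat => /orP[/bX//|/ysX[[]]].
move=> u uP.
have ->: u = (D `|` U)%fset.
  apply/fsetP => j; rewrite uP big_cat /= -/(h j).
  rewrite !inE; have [jE|jE] := boolP (j \in E) => /=.
    rewrite ysE // QB //; last exact: ltnW.
    by have [/UE|_] := boolP (j \in U); [rewrite jE|rewrite orbF].
  by rewrite hE // mul1r ysU.
set w := (D `|` U)%fset.
have countw p : P p -> count p w = (count p D + m * q p)%N.
  move=> Pp; rewrite count_fsetU_disjoint ?UP // => j.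
  by rewrite !inE => /andP[jE _]; apply/negP => /UE; rewrite jE.
have sizew : #|` w| = (#|` D| + m * q xpredT)%N.
  by have := countw xpredT (or_introl erefl); rewrite !count_predT.
rewrite /decode sizew mcode choice.pickleK /= addKn mulnK // -map_comp.
rewrite (_ : map _ _ = map (rank w) a); last first.
  by apply/eq_in_map => t ta /=; rewrite /rank countw //; right; exists t.
have aw t : t \in a -> t \in w.
  move=> ta; have ht : h t != 1 := ba _ ta.
  have tE : t \in E by apply: contraR ht => /hE ->.
  by rewrite !inE tE hB.
apply/fsetP => i; rewrite inE /=; apply/andP/idP => [[iw /mapP[t ta eit]]|ia].
  by rewrite (rank_inj iw (aw _ ta) eit).
by split; [apply: aw|apply: map_f].
Qed.

End Decoding.

(** * Finite sums in the semigroup and relabelling by the cardinal *)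

(** The recursion stops at singletons, so the sum of a nonempty list is never [None]. *)
Lemma sum_in_FS (G : addSemigroupType) (I : Type) (F : G -> I -> algC) :
  (forall x y j, F (x + y) j = F x j * F y j) ->
  forall (X : set G) (l : seq G), l <> [::] -> uniq l -> (forall x, x \in l -> X x) ->
  exists2 s, FS X s & forall j, F s j = \prod_(x <- l) F x j.
Proof.
move=> FD X l l0 ul lX.
pose sum (s : seq G) := \big[oAC (@Algebra.addrA G) (@Algebra.addrC G)/None]_(x <- s) Some x.
have sumP s : s <> [::] -> exists2 t, sum s = Some t & forall j, F t j = \prod_(x <- s) F x j.
  rewrite /sum; elim: s => // x s IH _.
  case: s IH => [_|y s IH]; first by exists x => [|j]; rewrite big_seq1.
  have [//|t st tP] := IH; exists (x + t) => [|j]; first by rewrite big_cons st oACE.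
  by rewrite big_cons FD tP.
have [t lt tP] := sumP l l0; exists t => //; exists [fset x in l]%fset; split.
- case: l l0 {ul lX lt tP} => // x s _; apply/fset0Pn; exists x.
  by rewrite !inE eqxx.
- by move=> x /=; rewrite !inE; apply: lX.
- rewrite -lt; apply: perm_big; apply: uniq_perm => //.
  by move=> x; rewrite !inE.
Qed.

Theorem theorem2p7 (G : addSemigroupType)
    (cancel_add : forall x y z : G, x + y = x + z -> y = z)
    (kappa : choiceType)
    (card_G : [set: G] #= [set: kappa])
    (uncountable_kappa : ~ countable [set: kappa]) :
  exists d : G -> {fset kappa},
    forall X : set G, ~ countable X ->
      exists A : set kappa, A #= X /\
        [set a : {fset kappa} | [set` a] `<=` A] `<=` [set d s | s in FS X].
Proof.
have [F [F_inj F_neq0 F_fin FD]] := semigroup_embedding cancel_add.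
have [le [le_total le_anti le_trans]] := total_order_exists G.
(* Coordinates are elements of [G]; a bijection relabels them by elements of [kappa]. *)
have [f [f_inj f_surj]] : exists f : G -> kappa, injective f /\ forall k, exists x, f x = k.
  have /card_bijP[f /[dup] /bij_inj f_inj [g _ gK]] := card_G.
  exists (fun x => set_val (f (to_setT x))); split=> [x y /val_inj/f_inj|k].
    by move=> /(congr1 set_val).
  exists (set_val (g (to_setT k))).
  have -> : to_setT (set_val (g (to_setT k))) = g (to_setT k) by apply: val_inj.
  by rewrite gK.
pose d s := (f @` decode le (supp F s))%fset.
exists d => X Xunc.
have [A [r [first [AX [ranti rmin] firstX firstmin firstinj]]]] :=
  first_coordinates F_inj F_fin Xunc.
exists (f @` A); split; first exact: card_eq_trans (inj_card_eq (in2W f_inj)) AX.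
move=> a aA.
have [a' a'A ->] : exists2 a' : {fset G}, [set` a'] `<=` A & a = (f @` a')%fset.
  have [g gK] := choice f_surj.
  exists (g @` a)%fset => [x /= /imfsetP[k /= /aA[y Ay <-] ->]|].
    by rewrite (f_inj _ _ (gK (f y))).
  apply/fsetP => k; apply/idP/imfsetP => [ka|[_ /= /imfsetP[k' /= ka ->] ->]].
    by exists (g k); rewrite ?gK //; apply: in_imfset.
  by rewrite gK.
have [b [ub bX ba]] := triangular_sums ranti rmin firstX firstmin firstinj a'A.
have [l [l0 ul lX lP]] :=
  decodable_sum le_total le_anti le_trans F_inj F_neq0 F_fin Xunc ub bX ba.
have [s sX sP] := sum_in_FS FD l0 ul lX.
exists s => //; rewrite /d lP // => j.
by rewrite (in_supp F_fin) sP.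
Qed.
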